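(* Let $\mathsf{Y}$ be a finite set, $s:\mathsf{Y}\to\mathbb{R}^m$, $\mathcal{S}=\sup_{x\in\mathsf{Y}}\|s(x)\|$, $q_\theta(x)=\exp(\theta^T s(x))$, $Z(\theta)=\sum_{x\in\mathsf{Y}}q_\theta(x)$, $f(x|\theta)=q_\theta(x)/Z(\theta)$. Let $\Theta\subseteq\mathbb{R}^m$ be a bounded measurable set of positive Lebesgue measure, $T=\sup_{\theta\in\Theta}\|\theta\|$ and $\mathcal{K}=\exp(T\mathcal{S})$. Fix observed data $y\in\mathsf{Y}$, a prior density $\pi$ on $\Theta$ and proposal densities $h(\cdot|\theta)$ on $\Theta$, and assume (A1) there is $c_\pi$ with $1/c_\pi\le\pi(\theta)\le c_\pi$ for all $\theta\in\Theta$; (A2) there is $c_h$ with $1/c_h\le h(\theta'|\theta)\le c_h$ for all $\theta,\theta'\in\Theta$. Let $P$ be the Metropolis–Hastings kernel targeting the posterior $\pi(\theta|y)\propto\pi(\theta)f(y|\theta)$ with proposal $h$ and ratio $\alpha(\theta,\theta')=\frac{q_{\theta'}(y)\pi(\theta')h(\theta|\theta')}{q_\theta(y)\pi(\theta)h(\theta'|\theta)}\frac{Z(\theta)}{Z(\theta')}$, i.e. $P(\theta,{\rm d}\theta')=\delta_\theta({\rm d}\theta')[1-\int h(t|\theta)\min(1,\alpha(\theta,t)){\rm d}t]+h(\theta'|\theta)\min(1,\alpha(\theta,\theta')){\rm d}\theta'$. For $N\ge1$ let $\hat P$ be the noisy exchange kernel: from $\theta$, draw $\theta'\sim h(\cdot|\theta)$,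 draw $y'_1,\dots,y'_N$ i.i.d. from $f(\cdot|\theta')$, and move to $\theta'$ with probability $\min(1,\hat\alpha(\theta,\theta',y'))$ where $$\hat\alpha(\theta,\theta',y')=\frac{q_{\theta'}(y)\pi(\theta')h(\theta|\theta')}{q_\theta(y)\pi(\theta)h(\theta'|\theta)}\cdot\frac1N\sum_{i=1}^N\frac{q_\theta(y'_i)}{q_{\theta'}(y'_i)},$$ otherwise stay at $\theta$. Then for all $\theta,\theta'\in\Theta$, $$\delta(\theta,\theta'):=\frac{1}{\sqrt N}\,\frac{h(\theta|\theta')\pi(\theta')q_{\theta'}(y)}{h(\theta'|\theta)\pi(\theta)q_\theta(y)}\sqrt{{\rm Var}_{x\sim f(\cdot|\theta')}\Big(\frac{q_\theta(x)}{q_{\theta'}(x)}\Big)}\le\frac{c_h^2c_\pi^2\mathcal{K}^4}{\sqrt N},$$ so in particular $\mathbb{E}_{y'_1,\dots,y'_N\sim f(\cdot|\theta')}|\hat\alpha(\theta,\theta',y')-\alpha(\theta,\theta')|\le c_h^2c_\pi^2\mathcal{K}^4/\sqrt N$; and there is a constant $\mathcal{C}=\mathcal{C}(c_\pi,c_h,\mathcal{K})<\infty$, depending only on $c_\pi,c_h,\mathcal{K}$, such that for all $n\in\mathbb{N}$ and $N\ge1$, $$\sup_{\theta_0\in\Theta}\|\delta_{\theta_0}P^n-\delta_{\theta_0}\hat P^n\|\le\frac{\mathcal{C}}{\sqrt N}.$$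
   Context: $\|\mu-\nu\|=\sup_A|\mu(A)-\nu(A)|$ is the total variation distance; $\delta_{\theta_0}P^n$ is the law after $n$ steps of the chain with kernel $P$ started at $\theta_0$. $f(\cdot|\theta)$ is a Gibbs random field with sufficient statistic $s$. *)

(* Defs.v *)
From HB Require Import structures.
From mathcomp Require Import all_boot all_order all_algebra.
From mathcomp Require Import all_classical all_reals all_analysis.
Set Implicit Arguments. Unset Strict Implicit. Unset Printing Implicit Defensive.
Import Order.TTheory GRing.Theory Num.Theory.
Local Open Scope classical_set_scope.
Local Open Scope ring_scope.

Section Defs.
Variable R : realType.

(* points of R^m are m-tuples of reals; product (= Borel) sigma-algebra *)
Definition vec (m : nat) := (m.-tuple R).

Definition dotv (m : nat) (u v : vec m) : R := \sum_(i < m) tnth u i * tnth v i.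
Definition normv (m : nat) (u : vec m) : R := Num.sqrt (dotv u u).

(* m-dimensional Lebesgue integral of a nonnegative function, as iterated
   one-dimensional Lebesgue integrals (Tonelli). *)
Fixpoint leb_int (m : nat) : (vec m -> \bar R) -> \bar R :=
  match m return (vec m -> \bar R) -> \bar R with
  | 0 => fun f => f [tuple]
  | m'.+1 => fun f =>
      (\int[@lebesgue_measure R]_x leb_int (fun t : vec m' => f (cons_tuple x t)))%E
  end.

Definition LInt (m : nat) (A : set (vec m)) (g : vec m -> R) : R :=
  fine (leb_int (fun t => (\1_A t * g t)%:E)).

Definition leb_measure (m : nat) (A : set (vec m)) : \bar R :=
  leb_int (fun t => (\1_A t)%:E).

Variables (m : nat) (Y : finType) (s : Y -> vec m).

Definition qf (th : vec m) (x : Y) : R := expR (dotv th (s x)).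
Definition Zf (th : vec m) : R := \sum_(x : Y) qf th x.
Definition lik (th : vec m) (x : Y) : R := qf th x / Zf th.

(* sup_{x in Y} ||s(x)||  (norms are >= 0) *)
Definition Sconst : R := \big[Num.max/0]_(x : Y) normv (s x).

(* Convention: [h th th'] is the proposal density h(th' | th). *)
Variables (pi : vec m -> R) (h : vec m -> vec m -> R) (y : Y).

Definition alpha (th th' : vec m) : R :=
  (qf th' y * pi th' * h th' th) / (qf th y * pi th * h th th') * (Zf th / Zf th').

Definition alpha_hat (N : nat) (th th' : vec m) (y' : N.-tuple Y) : R :=
  (qf th' y * pi th' * h th' th) / (qf th y * pi th * h th th') *
  (N%:R^-1 * \sum_(i < N) (qf th (tnth y' i) / qf th' (tnth y' i))).

Definition iid_prob (N : nat) (th' : vec m) (y' : N.-tuple Y) : R :=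
  \prod_(i < N) lik th' (tnth y' i).

Variable Theta : set (vec m).

(* Action of the MH kernel P on a (bounded, nonnegative) function g:
   (P g)(th) = int P(th, d th') g(th'), with
   P(th, d th') = delta_th(d th') [1 - int h(t|th) min(1, alpha(th,t)) dt]
                  + h(th'|th) min(1, alpha(th,th')) d th'. *)
Definition MH_op (g : vec m -> R) (th : vec m) : R :=
  (1 - LInt Theta (fun t => h th t * Num.min 1 (alpha th t))) * g th
  + LInt Theta (fun t => h th t * Num.min 1 (alpha th t) * g t).

(* Action of the noisy exchange kernel P_hat on g: propose th' ~ h(.|th),
   draw y'_1..y'_N iid f(.|th'), accept with prob. min(1, alpha_hat). *)
Definition noisy_op (N : nat) (g : vec m -> R) (th : vec m) : R :=
  LInt Theta (fun t => h th t *
    \sum_(y' : N.-tuple Y) iid_prob t y' *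
       (Num.min 1 (alpha_hat th t y') * g t
        + (1 - Num.min 1 (alpha_hat th t y')) * g th)).

(* (delta_{th0} K^n)(A) = (K^n 1_A)(th0) *)
Definition law_after (K : (vec m -> R) -> vec m -> R) (n : nat)
  (th0 : vec m) (A : set (vec m)) : R :=
  iter n K (fun t => \1_A t) th0.

Definition mean_lik (th' : vec m) (r : Y -> R) : R :=
  \sum_(x : Y) lik th' x * r x.
Definition var_lik (th' : vec m) (r : Y -> R) : R :=
  mean_lik th' (fun x => (r x - mean_lik th' r) ^+ 2).

End Defs.

(* Main.v *)
Require Import Defs.
From HB Require Import structures.
From mathcomp Require Import all_boot all_order all_algebra.
From mathcomp Require Import all_classical all_reals all_analysis measurable_realfun.
From mathcomp Require Import ring lra.
Import Order.TTheory GRing.Theory Num.Theory.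
Local Open Scope classical_set_scope.
Local Open Scope ring_scope.


(* Both kernels are accept/reject kernels with the same proposal [h]; they differ only in
   the acceptance probability, and the two probabilities are within [beta] of each other,
   where [beta] bounds E|alpha_hat - alpha| <= sd / sqrt N (Cauchy-Schwarz for an unbiased
   average of N i.i.d. importance ratios).  Since [h * min(1, alpha)] is bounded below by a
   constant [kappa], the exact kernel satisfies a Doeblin condition with mass [kappa |Theta|],
   hence contracts the oscillation of functions by [1 - kappa |Theta|].  In
     P^(n+1) 1_A - Phat^(n+1) 1_A = (P - Phat) P^n 1_A + Phat (P^n 1_A - Phat^n 1_A)
   the first term is at most [beta] times the oscillation of [P^n 1_A] and [Phat] does not
   increase the sup norm, so the errors sum to a geometric series of sum
   [beta / (kappa |Theta|)]; finally [|Theta| >= 1 / c_h] because [h <= c_h] has mass one. *)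

(** * Iterated Lebesgue integrals *)

Lemma leb_int_ge0 (R : realType) m (f : m.-tuple R -> \bar R) :
  (forall v, (0 <= f v)%E) -> (0 <= leb_int f)%E.
Proof.
elim: m f => [|m IH] f f0 /=; first exact: f0.
by apply: integral_ge0 => x _; apply: IH.
Qed.

(** The parameter space [T] is arbitrary so that the induction can move the first coordinate into
    it: the hypothesis is used at [T * R], and Tonelli's theorem then integrates that coordinate
    out. *)
Lemma measurable_leb_int (R : realType) m d (T : measurableType d)
    (f : T * m.-tuple R -> \bar R) :
  measurable_fun setT f -> (forall p, (0 <= f p)%E) ->
  measurable_fun setT (fun t => leb_int (fun v => f (t, v))).
Proof.
elim: m d T f => [|m IH] d T f mf f0 /=.
  by apply: (measurableT_comp mf); exact: measurable_fun_pair.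
pose g (p : T * R) := leb_int (fun v : m.-tuple R => f (p.1, cons_tuple p.2 v)).
have mg : measurable_fun setT g.
  apply: (IH _ _ (fun q : (T * R) * m.-tuple R => f (q.1.1, cons_tuple q.1.2 q.2))).
    apply: (measurableT_comp mf); apply: measurable_fun_pair.
      exact: measurableT_comp measurable_fst measurable_fst.
    apply: measurable_cons; last exact: measurable_snd.
    exact: measurableT_comp measurable_snd measurable_fst.
  by move=> q; exact: f0.
apply: (measurable_fun_fubini_tonelli_F (m2 := @lebesgue_measure R) g mg).
by move=> p; apply: leb_int_ge0 => v; exact: f0.
Qed.

Lemma measurable_leb_int_cons (R : realType) m (f : m.+1.-tuple R -> \bar R) :
  measurable_fun setT f -> (forall p, (0 <= f p)%E) ->
  measurable_fun setT (fun x : R => leb_int (fun v => f (cons_tuple x v))).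
Proof.
move=> mf f0.
apply: (@measurable_leb_int R m _ _ (fun q : R * m.-tuple R => f (cons_tuple q.1 q.2))).
  apply: (measurableT_comp mf).
  by apply: measurable_cons; [exact: measurable_fst|exact: measurable_snd].
by move=> q; exact: f0.
Qed.

Lemma measurable_cons_tuple (R : realType) m (x : R) :
  measurable_fun setT (fun v : m.-tuple R => cons_tuple x v : m.+1.-tuple R).
Proof. by apply: measurable_cons; [exact: measurable_cst|exact: measurable_id]. Qed.

Lemma leb_intD (R : realType) m (f g : m.-tuple R -> \bar R) :
  measurable_fun setT f -> (forall v, (0 <= f v)%E) ->
  measurable_fun setT g -> (forall v, (0 <= g v)%E) ->
  leb_int (fun v => f v + g v)%E = (leb_int f + leb_int g)%E.
Proof.
elim: m f g => [//|m IH] f g mf f0 mg g0 /=.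
rewrite -ge0_integralD//.
- apply: eq_integral => x _; apply: IH => //;
  exact: measurableT_comp (measurable_cons_tuple _ _ _).
- by move=> x _; apply: leb_int_ge0.
- exact: measurable_leb_int_cons.
- by move=> x _; apply: leb_int_ge0.
- exact: measurable_leb_int_cons.
Qed.

Lemma leb_intZl (R : realType) m (c : R) (f : m.-tuple R -> \bar R) :
  measurable_fun setT f -> (forall v, (0 <= f v)%E) -> 0 <= c ->
  leb_int (fun v => c%:E * f v)%E = (c%:E * leb_int f)%E.
Proof.
move=> + + c0; elim: m f => [//|m IH] f mf f0 /=.
rewrite -ge0_integralZl_EFin//.
- apply: eq_integral => x _; apply: IH => //;
  exact: measurableT_comp (measurable_cons_tuple _ _ _).
- by move=> x _; apply: leb_int_ge0.
- exact: measurable_leb_int_cons.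
Qed.

Lemma le_leb_int (R : realType) m (f g : m.-tuple R -> \bar R) :
  measurable_fun setT f -> measurable_fun setT g ->
  (forall v, (0 <= f v)%E) -> (forall v, (f v <= g v)%E) ->
  (leb_int f <= leb_int g)%E.
Proof.
elim: m f g => [|m IH] f g mf mg f0 fg /=; first exact: fg.
have g0 v : (0 <= g v)%E by apply: le_trans (fg v).
apply: ge0_le_integral => //.
- by move=> x _; apply: leb_int_ge0.
- exact: measurable_leb_int_cons.
- exact: measurable_leb_int_cons.
- move=> x _; apply: IH => //;
  exact: measurableT_comp (measurable_cons_tuple _ _ _).
Qed.

(** * Integrals of bounded functions on a set of finite measure *)

Lemma LInt_eq (R : realType) m (D : set (m.-tuple R)) (f g : m.-tuple R -> R) :
  (forall t, D t -> f t = g t) -> LInt D f = LInt D g.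
Proof.
move=> fg; rewrite /LInt; congr (fine (leb_int _)); apply/funext => t.
by rewrite indicE; case: (boolP (t \in D)) => [/set_mem/fg->//|]; rewrite !mul0r.
Qed.

Lemma measurable_indicM (R : realType) d (T : measurableType d) (D : set T)
    (f : T -> R) : measurable D -> measurable_fun D f ->
  measurable_fun setT (fun t => \1_D t * f t).
Proof.
move=> mD mf; rewrite -(setUv D); apply/measurable_funU => //.
  exact: measurableC.
split.
  apply: (eq_measurable_fun f) => // t Dt.
  by rewrite indicE Dt mul1r.
apply: (eq_measurable_fun (fun=> 0 : R)) => [t|//].
by rewrite in_setC indicE => /negbTE ->; rewrite mul0r.
Qed.

Section bounded_integrals.
Variables (R : realType) (m : nat) (D : set (m.-tuple R)).
Hypothesis mD : measurable D.

Let cut (f : m.-tuple R -> R) t : \bar R := (\1_D t * f t)%:E.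

Let measurable_cut (f : m.-tuple R -> R) : measurable_fun D f -> measurable_fun setT (cut f).
Proof.
by move=> mf; apply/measurable_EFinP; exact: measurable_indicM.
Qed.

Let cut_ge0 (f : m.-tuple R -> R) : (forall t, D t -> 0 <= f t) -> forall t, (0 <= cut f t)%E.
Proof.
move=> f0 t; rewrite /cut lee_fin indicE.
by case: (boolP (t \in D)) => [/set_mem/f0 ?|_]; rewrite ?mul1r ?mul0r.
Qed.

Lemma LInt_ge0 (f : m.-tuple R -> R) : (forall t, D t -> 0 <= f t) -> 0 <= LInt D f.
Proof. by move=> f0; apply/fine_ge0/leb_int_ge0/cut_ge0. Qed.

Lemma leb_measure_lty (h : m.-tuple R -> R) (c : R) :
  0 < c -> measurable_fun D h -> (forall t, D t -> c^-1 <= h t) ->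
  LInt D h = 1 -> (leb_measure D < +oo)%E.
Proof.
move=> c0 mh hc h1.
have h0 t : D t -> 0 <= h t.
  by move=> Dt; apply: le_trans (hc _ Dt); rewrite invr_ge0 ltW.
(* Since [fine] sends infinite values to 0, a real integral equal to 1 forces the extended integral
   to be finite. *)
have h_fin : leb_int (cut h) = 1%E.
  move: h1; rewrite /LInt; have := leb_int_ge0 _ _ _ (cut_ge0 _ h0).
  by rewrite -/(cut h); case: (leb_int (cut h)) => //= [r _ ->//|_ /esym/eqP]; rewrite oner_eq0.
have mi : measurable_fun setT (fun t => (\1_D t)%:E : \bar R).
  by apply/measurable_EFinP; exact: measurable_indic.
suff : (leb_measure D <= c%:E)%E by move=> /le_lt_trans; apply; exact: ltry.
rewrite -[leLHS]mul1e -(@divff _ c) ?gt_eqF// EFinM -muleA -[leRHS]mule1.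
have ci0 : 0 <= c^-1 by rewrite invr_ge0 ltW.
rewrite lee_pmul2l//= -h_fin -leb_intZl//.
apply: le_leb_int.
- by apply: measurable_funeM.
- exact: measurable_cut.
- by move=> t; rewrite mule_ge0// lee_fin ?indicE.
- move=> t; rewrite /cut -EFinM lee_fin indicE.
  by case: (boolP (t \in D)) => [/set_mem/hc|_]; rewrite ?mulr0 ?mul0r// mulr1 mul1r.
Qed.

Hypothesis D_fin : (leb_measure D < +oo)%E.

Let leb_int_cut_fin {f : m.-tuple R -> R} {C} : measurable_fun D f ->
  (forall t, D t -> 0 <= f t <= C) -> leb_int (cut f) \is a fin_num.
Proof.
move=> mf fC.
have f0 t : D t -> 0 <= f t by move=> /fC/andP[].
rewrite ge0_fin_numE; last exact: leb_int_ge0 (cut_ge0 _ f0).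
have mi : measurable_fun setT (fun t => (\1_D t)%:E : \bar R).
  by apply/measurable_EFinP; exact: measurable_indic.
have i0 t : (0 <= (\1_D t)%:E :> \bar R)%E by rewrite lee_fin indicE.
(* The absolute value keeps the dominating constant nonnegative even for empty [D], where [C] may be
   negative. *)
apply: (@le_lt_trans _ _ (`|C|%:E * leb_measure D)%E); last first.
  by apply: lte_mul_pinfty.
rewrite -leb_intZl//; apply: le_leb_int.
- exact: measurable_cut.
- exact: measurable_funeM.
- exact: cut_ge0.
- move=> t; rewrite /cut -EFinM lee_fin indicE.
  case: (boolP (t \in D)) => [/set_mem/fC/andP[_ fC']|_]; rewrite ?mulr0 ?mul0r// mulr1 mul1r.
  exact: le_trans (ler_norm _).
Qed.

Lemma LIntD (f g : m.-tuple R -> R) C : measurable_fun D f -> (forall t, D t -> 0 <= f t <= C) ->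
  measurable_fun D g -> (forall t, D t -> 0 <= g t <= C) ->
  LInt D (fun t => f t + g t) = LInt D f + LInt D g.
Proof.
move=> mf fC mg gC; rewrite /LInt -fineD; [|exact: (leb_int_cut_fin _ fC)|exact: (leb_int_cut_fin _ gC)].
have f0 t : D t -> 0 <= f t by move=> /fC/andP[].
have g0 t : D t -> 0 <= g t by move=> /gC/andP[].
rewrite -leb_intD; [|exact: measurable_cut|exact: cut_ge0|exact: measurable_cut|exact: cut_ge0].
by congr (fine (leb_int _)); apply/funext => t; rewrite -EFinD mulrDr.
Qed.

Lemma LIntZl (f : m.-tuple R -> R) C c : measurable_fun D f -> (forall t, D t -> 0 <= f t <= C) ->
  0 <= c -> LInt D (fun t => c * f t) = c * LInt D f.
Proof.
move=> mf fC c0; rewrite /LInt.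
have f0 t : D t -> 0 <= f t by move=> /fC/andP[].
rewrite -[c]/(fine c%:E) -fineM//; last exact: (leb_int_cut_fin _ fC).
rewrite -leb_intZl//; [|exact: measurable_cut|exact: cut_ge0].
by congr (fine (leb_int _)); apply/funext => t /=; rewrite -EFinM mulrCA.
Qed.

(** The bound [C] makes both integrals finite; [fine] is not monotone at infinity. *)
Lemma le_LInt (f g : m.-tuple R -> R) C : measurable_fun D f -> measurable_fun D g ->
  (forall t, D t -> [/\ 0 <= f t, f t <= g t & g t <= C]) ->
  LInt D f <= LInt D g.
Proof.
move=> mf mg fgC.
have fC t : D t -> 0 <= f t <= C.
  by move=> /fgC[? ? ?]; apply/andP; split=> //; apply: le_trans; eassumption.
have gC t : D t -> 0 <= g t <= C.
  by move=> /fgC[? ? ?]; apply/andP; split=> //; apply: le_trans; eassumption.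
apply: fine_le; [exact: (leb_int_cut_fin _ fC)|exact: (leb_int_cut_fin _ gC)|].
apply: le_leb_int; [exact: measurable_cut|exact: measurable_cut| |].
  by apply: cut_ge0 => t /fC/andP[].
move=> t; rewrite lee_fin indicE.
by case: (boolP (t \in D)) => [/set_mem/fgC[]|_]; rewrite ?mul0r ?mul1r.
Qed.

Lemma measurable_LInt (u : m.-tuple R -> m.-tuple R -> R) :
  measurable_fun (D `*` D) (fun p => u p.1 p.2) ->
  (forall t t', D t -> D t' -> 0 <= u t t') ->
  measurable_fun D (fun t => LInt D (u t)).
Proof.
move=> mu u0.
(* [u] is measurable on [D * D] only; extended by zero, it falls under the measurability of
   parametric integrals on the whole space. *)
pose F (p : m.-tuple R * m.-tuple R) : \bar R := (\1_(D `*` D) p * u p.1 p.2)%:E.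
have mF : measurable_fun setT F.
  apply/measurable_EFinP; apply: (measurable_indicM _ _ _ _ (fun p => u p.1 p.2)) => //.
  exact: measurableX.
have F0 p : (0 <= F p)%E.
  rewrite /F lee_fin indicE; case: (boolP (p \in _)) => [/set_mem [? ?]|_].
    by rewrite mul1r u0.
  by rewrite mul0r.
apply: (eq_measurable_fun (fun t => fine (leb_int (fun v => F (t, v))))).
  move=> t /set_mem Dt; congr (fine (leb_int _)); apply/funext => v.
  have E : ((t, v) \in D `*` D) = (v \in D).
    by apply/idP/idP => [/set_mem[_ /= Dv]|/set_mem Dv]; rewrite inE.
  by rewrite /F /= !indicE E.
apply: measurable_funTS; apply: measurableT_comp; first exact: fine_measurable.
exact: measurable_leb_int.
Qed.

End bounded_integrals.

(** * Perturbation of accept/reject kernels *)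

Lemma measurable_fun_fstX (R : realType) d1 d2 (T1 : measurableType d1)
    (T2 : measurableType d2) (A : set T1) (B : set T2) (f : T1 -> R) :
  measurable A -> measurable B -> measurable_fun A f ->
  measurable_fun (A `*` B) (fun p => f p.1).
Proof.
move=> mA mB mf; apply: (measurable_comp (F := A) (f := f) (g := fst)) => //.
  by move=> _ [[? ?] [? ?] <-].
exact: measurable_funTS.
Qed.

Lemma measurable_fun_sndX (R : realType) d1 d2 (T1 : measurableType d1)
    (T2 : measurableType d2) (A : set T1) (B : set T2) (f : T2 -> R) :
  measurable A -> measurable B -> measurable_fun B f ->
  measurable_fun (A `*` B) (fun p => f p.2).
Proof.
move=> mA mB mf; apply: (measurable_comp (F := B) (f := f) (g := snd)) => //.
  by move=> _ [[? ?] [? ?] <-].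
exact: measurable_funTS.
Qed.

Lemma measurable_slice (R : realType) m (D : set (m.-tuple R))
    (u : m.-tuple R -> m.-tuple R -> R) t :
  measurable D -> measurable_fun (D `*` D) (fun p => u p.1 p.2) -> D t ->
  measurable_fun D (u t).
Proof.
move=> mD mu Dt.
apply: (measurable_comp (F := D `*` D) (f := fun p => u p.1 p.2) (g := pair t)) => //.
- exact: measurableX.
- by move=> _ [v Dv <-].
- by apply: measurable_funTS; exact: measurable_fun_pair.
Qed.

Section accept_reject_kernels.
Variables (R : realType) (m : nat) (D : set (m.-tuple R)).
Variables (h : m.-tuple R -> m.-tuple R -> R) (ch : R).
Hypotheses (mD : measurable D) (D_fin : (leb_measure D < +oo)%E).
Hypothesis ch_gt0 : 0 < ch.
Hypothesis mh : measurable_fun (D `*` D) (fun p => h p.1 p.2).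
Hypothesis h_bnd : forall t t', D t -> D t' -> 0 <= h t t' <= ch.
Hypothesis h_int : forall t, D t -> LInt D (h t) = 1.

Let V := LInt D (fun=> 1).

(** Since [h th] has mass one, the rejection mass fits under the integral. For an acceptance
    probability [a], the value at [th] is then an average of convex combinations of values of
    [g]. *)
Definition accept_op (a : m.-tuple R -> m.-tuple R -> R) (g : m.-tuple R -> R) th :=
  LInt D (fun t => h th t * (a th t * g t + (1 - a th t) * g th)).

(** This class contains the indicators of measurable sets and is stable under [accept_op]; its
    bounds supply the nonnegativity and domination that additivity of [LInt] asks for. *)
Definition unit_fun (g : m.-tuple R -> R) :=
  measurable_fun D g /\ forall t, D t -> 0 <= g t <= 1.

Definition acceptance (a : m.-tuple R -> m.-tuple R -> R) :=
  measurable_fun (D `*` D) (fun p => a p.1 p.2) /\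
  forall t t', D t -> D t' -> 0 <= a t t' <= 1.

Let LInt_const c : 0 <= c -> LInt D (fun=> c) = c * V.
Proof.
move=> c0; rewrite -(LIntZl _ _ _ mD D_fin (fun=> 1) 1)// => [|t _].
  by apply: LInt_eq => t _; rewrite mulr1.
by rewrite ler01 lexx.
Qed.

(** The density [h th] has mass one and lies below [ch], so [1 <= ch * V]. *)
Lemma inv_le_volume th : D th -> ch^-1 <= V.
Proof.
move=> Dth; rewrite -[_^-1]mul1r ler_pdivrMr// mulrC -(LInt_const _ (ltW ch_gt0)).
rewrite -(h_int _ Dth); apply: (le_LInt _ _ _ mD D_fin _ _ ch) => //.
  exact: measurable_slice.
by move=> t Dt; have /andP[] := h_bnd _ _ Dth Dt.
Qed.

(** * One step of the kernel from a fixed state *)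

Section fixed_state.
Variable th : m.-tuple R.
Hypothesis Dth : D th.

Let mhth : measurable_fun D (h th). Proof. exact: measurable_slice. Qed.

Let hth0 t : D t -> 0 <= h th t. Proof. by move=> /(h_bnd _ _ Dth)/andP[]. Qed.

Let hthC t : D t -> h th t <= ch. Proof. by move=> /(h_bnd _ _ Dth)/andP[]. Qed.

Let wint_bnd (u : m.-tuple R -> R) C t : (forall t, D t -> 0 <= u t <= C) -> D t ->
  0 <= h th t * u t <= ch * C.
Proof.
move=> uC Dt; have /andP[u0 u1] := uC _ Dt.
by rewrite mulr_ge0 ?hth0//= ler_pM ?hth0 ?hthC.
Qed.

Lemma LInt_proposal_cst c : 0 <= c -> LInt D (fun t => h th t * c) = c.
Proof.
move=> c0; rewrite -[RHS]mulr1 -(h_int _ Dth).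
rewrite -(LIntZl _ _ _ mD D_fin _ ch)//; last by move=> t Dt; rewrite hth0 ?hthC.
by apply: LInt_eq => t _; rewrite mulrC.
Qed.

(** [LInt] is additive only on nonnegative functions, so differences are compared one side at a
    time, with the error [e] added to the larger side and written as its own average under
    [h th]. *)
Lemma LInt_proposal_shift (u v : m.-tuple R -> R) C e :
  measurable_fun D u -> (forall t, D t -> 0 <= u t <= C) ->
  measurable_fun D v -> (forall t, D t -> 0 <= v t <= C) ->
  0 <= e -> (forall t, D t -> u t <= v t + e) ->
  LInt D (fun t => h th t * u t) <= LInt D (fun t => h th t * v t) + e.
Proof.
move=> mu uC mv vC e0 uv.
have C0 : 0 <= C by have /andP[a b] := uC _ Dth; exact: le_trans b.
rewrite -[in leRHS](LInt_proposal_cst _ e0).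
rewrite -(LIntD _ _ _ mD D_fin _ _ (ch * (C + e))).
- apply: (le_LInt _ _ _ mD D_fin _ _ (ch * (C + e) + ch * (C + e))).
  + exact: measurable_funM.
  + by apply: measurable_funD; apply: measurable_funM.
  + move=> t Dt; split.
    * by have /andP[] := wint_bnd _ _ _ uC Dt.
    * by rewrite -mulrDr ler_wpM2l ?hth0 ?uv.
    * have /andP[a b] := vC _ Dt.
      by rewrite lerD// ler_pM ?hth0 ?hthC// ?lerDr// (le_trans b)// lerDl.
- exact: measurable_funM.
- move=> t Dt; apply: (wint_bnd v) => // {Dt}t Dt; have /andP[-> b] := vC _ Dt.
  by rewrite (le_trans b)// lerDl.
- exact: measurable_funM.
- by move=> t Dt; apply: (wint_bnd (fun=> e)) => // {Dt}t Dt; rewrite e0 lerDr.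
Qed.

Lemma LInt_proposal_bnd (u : m.-tuple R -> R) : unit_fun u ->
  0 <= LInt D (fun t => h th t * u t) <= 1.
Proof.
move=> [mu u1]; apply/andP; split.
  by apply: LInt_ge0 => t Dt; rewrite mulr_ge0 ?hth0//; have /andP[] := u1 _ Dt.
have := LInt_proposal_shift u (fun=> 0) 1 1 mu u1.
rewrite LInt_proposal_cst// add0r; apply => // t Dt; first by rewrite lexx ler01.
by have /andP[] := u1 _ Dt.
Qed.

Lemma unit_fun_mix a g : acceptance a -> unit_fun g ->
  unit_fun (fun t => a th t * g t + (1 - a th t) * g th).
Proof.
move=> [ma a01] [mg g01].
have math : measurable_fun D (a th) by exact: measurable_slice.
split=> [|t Dt].
  by apply: measurable_funD; apply: measurable_funM => //; exact: measurable_funB.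
have /andP[a0 a1] := a01 _ _ Dth Dt.
have /andP[g0 g1] := g01 _ Dt; have /andP[gth0 gth1] := g01 _ Dth.
have b0 : 0 <= 1 - a th t by rewrite subr_ge0.
rewrite addr_ge0 ?mulr_ge0//=.
have := ler_wpM2l a0 g1; have := ler_wpM2l b0 gth1; lra.
Qed.

(* The part [kappa] of the move density does not depend on the current state [th]; the
   remaining mass [1 - kappa V] averages values of [g] between [c] and [c + r]. *)
Lemma accept_op_doeblin a g c r kappa : acceptance a -> unit_fun g ->
  0 <= c -> 0 <= r -> (forall t, D t -> c <= g t <= c + r) ->
  0 <= kappa -> (forall t, D t -> kappa <= h th t * a th t) ->
  kappa * LInt D g + c * (1 - kappa * V) <= accept_op a g th
    <= kappa * LInt D g + (c + r) * (1 - kappa * V).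
Proof.
move=> [ma a01] [mg g01] c0 r0 gc k0 ka.
have math : measurable_fun D (a th) by exact: measurable_slice.
pose w t := a th t * g t + (1 - a th t) * g th.
have [mw w01] : unit_fun w by exact: unit_fun_mix.
have wb t : D t -> kappa * (g t - c) <= h th t * (w t - c) /\
    kappa * (c + r - g t) <= h th t * (c + r - w t).
  move=> Dt; have /andP[a0 a1] := a01 _ _ Dth Dt.
  have /andP[g0 g1] := g01 _ Dt; have /andP[gth0 gth1] := g01 _ Dth.
  have /andP[gl gu] := gc _ Dt; have /andP[gthl gthu] := gc _ Dth.
  have h0 := hth0 _ Dt; have hk := ka _ Dt.
  have b0 : 0 <= 1 - a th t by rewrite subr_ge0.
  rewrite /w; split.
  - apply: (@le_trans _ _ (h th t * (a th t * (g t - c)))).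
      by rewrite mulrA ler_wpM2r ?subr_ge0.
    by apply: ler_wpM2l => //; have := ler_wpM2l b0 gthl; lra.
  - apply: (@le_trans _ _ (h th t * (a th t * (c + r - g t)))).
      by rewrite mulrA ler_wpM2r ?subr_ge0.
    by apply: ler_wpM2l => //; have := ler_wpM2l b0 gthu; lra.
have mkg : measurable_fun D (fun t => kappa * g t) by exact: measurable_funM.
have mhw : measurable_fun D (fun t => h th t * w t) by exact: measurable_funM.
have cr0 : 0 <= c + r by rewrite addr_ge0.
have kgE : LInt D (fun t => kappa * g t) = kappa * LInt D g.
  exact: (LIntZl _ _ _ mD D_fin _ 1).
(* Both comparisons are integrated with all terms on the side where they are nonnegative. *)
have key (C : R) : 0 <= C ->
  (LInt D (fun t => h th t * w t + C * kappa) = accept_op a g th + C * kappa * V) *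
  (LInt D (fun t => h th t * C + kappa * g t) = C + kappa * LInt D g).
  move=> C0; have Ck0 : 0 <= C * kappa by exact: mulr_ge0.
  split.
    rewrite (LIntD _ _ _ mD D_fin _ _ (ch * 1 + C * kappa))//.
    - by rewrite LInt_const.
    - move=> t Dt; have /andP[-> b] := wint_bnd _ _ _ w01 Dt.
      by rewrite (le_trans b)// lerDl.
    - by move=> t Dt; rewrite Ck0 lerDr mulr1 ltW.
  rewrite (LIntD _ _ _ mD D_fin _ _ (ch * C + kappa * 1))//.
  - by rewrite LInt_proposal_cst// kgE.
  - exact: measurable_funM.
  - move=> t Dt; have /andP[-> b] := wint_bnd (fun=> C) C _ (fun _ _ => introT andP (conj C0 (lexx C))) Dt.
    by rewrite (le_trans b)// lerDl mulr1.
  - move=> t Dt; have /andP[g0 g1] := g01 _ Dt.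
    rewrite mulr_ge0//= (@le_trans _ _ (kappa * 1)) ?ler_wpM2l//.
    by rewrite lerDr mulr_ge0// ltW.
have mD1 (C : R) : measurable_fun D (fun t => h th t * w t + C * kappa).
  exact: measurable_funD.
have mD2 (C : R) : measurable_fun D (fun t => h th t * C + kappa * g t).
  by apply: measurable_funD => //; exact: measurable_funM.
have bnd1 (C : R) t : 0 <= C -> D t -> 0 <= h th t * w t + C * kappa <= ch + C * kappa.
  move=> C0 Dt; have /andP[w0 w1] := w01 _ Dt.
  rewrite addr_ge0 ?mulr_ge0 ?hth0//= lerD2r -[leRHS]mulr1.
  by rewrite ler_pM ?hth0 ?hthC.
have bnd2 (C : R) t : 0 <= C -> D t -> 0 <= h th t * C + kappa * g t <= ch * C + kappa.
  move=> C0 Dt; have /andP[g0 g1] := g01 _ Dt.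
  rewrite addr_ge0 ?mulr_ge0 ?hth0//= lerD ?ler_wpM2r ?hthC//.
  by rewrite -[leRHS]mulr1 ler_wpM2l.
apply/andP; split.
- suff : LInt D (fun t => h th t * c + kappa * g t) <=
      LInt D (fun t => h th t * w t + c * kappa) by rewrite !key//; lra.
  apply: (le_LInt _ _ _ mD D_fin _ _ (ch + c * kappa)) => // t Dt.
  have /andP[_ u1] := bnd1 _ _ c0 Dt; have /andP[l2 _] := bnd2 _ _ c0 Dt.
  split=> //; have [+ _] := wb _ Dt; lra.
- suff : LInt D (fun t => h th t * w t + (c + r) * kappa) <=
      LInt D (fun t => h th t * (c + r) + kappa * g t) by rewrite !key//; lra.
  apply: (le_LInt _ _ _ mD D_fin _ _ (ch * (c + r) + kappa)) => // t Dt.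
  have /andP[l1 _] := bnd1 _ _ cr0 Dt; have /andP[_ u2] := bnd2 _ _ cr0 Dt.
  split=> //; have [_] := wb _ Dt; lra.
Qed.

(** The difference of the integrands splits into [a - b] times an increment of [f], at most
    [beta * r], and a convex combination of values of [f - g], at most [delta]; averaging under
    [h th] keeps the bound. *)
Lemma accept_op_diff a b f g c r beta delta :
  acceptance a -> acceptance b -> unit_fun f -> unit_fun g ->
  0 <= r -> (forall t, D t -> c <= f t <= c + r) ->
  (forall t, D t -> `|a th t - b th t| <= beta) ->
  (forall t, D t -> `|f t - g t| <= delta) ->
  `|accept_op a f th - accept_op b g th| <= beta * r + delta.
Proof.
move=> aa ab uf ug r0 fc abB fgd.
pose w (a : m.-tuple R -> m.-tuple R -> R) (f : m.-tuple R -> R) t :=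
  a th t * f t + (1 - a th t) * f th.
have [mwf wf] := unit_fun_mix _ _ aa uf; have [mwg wg] := unit_fun_mix _ _ ab ug.
have B0 : 0 <= beta := le_trans (normr_ge0 _) (abB _ Dth).
have d0 : 0 <= delta := le_trans (normr_ge0 _) (fgd _ Dth).
have e0 : 0 <= beta * r + delta by rewrite addr_ge0 ?mulr_ge0.
have wfg t : D t -> `|w a f t - w b g t| <= beta * r + delta.
  move=> Dt; have /andP[b0 b1] := ab.2 _ _ Dth Dt.
  have -> : w a f t - w b g t = (a th t - b th t) * (f t - f th)
      + (b th t * (f t - g t) + (1 - b th t) * (f th - g th)) by rewrite /w; ring.
  rewrite (le_trans (ler_normD _ _))// lerD//.
    rewrite normrM ler_pM ?abB// ler_norml.
    by have /andP[? ?] := fc _ Dt; have /andP[? ?] := fc _ Dth; apply/andP; split; lra.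
  rewrite (le_trans (ler_normD _ _))// !normrM (ger0_norm b0) [`|1 - _|]ger0_norm ?subr_ge0//.
  have := ler_wpM2l b0 (fgd _ Dt).
  have : (1 - b th t) * `|f th - g th| <= (1 - b th t) * delta.
    by rewrite ler_wpM2l ?subr_ge0 ?fgd.
  lra.
rewrite ler_distl; apply/andP; split; rewrite ?lerBlDr;
  apply: (LInt_proposal_shift _ _ 1) => // t Dt;
  by have := wfg _ Dt; rewrite ler_distl => /andP[]; rewrite /w; lra.
Qed.

End fixed_state.
Lemma unit_fun_accept_op a g : acceptance a -> unit_fun g ->
  unit_fun (accept_op a g).
Proof.
move=> aa ug; split; last first.
  by move=> t Dt; apply: LInt_proposal_bnd => //; exact: unit_fun_mix.
apply: measurable_LInt => //; last first.
  move=> t t' Dt Dt'; have /andP[h0 _] := h_bnd _ _ Dt Dt'.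
  by have [_ /(_ _ Dt')/andP[w0 _]] := unit_fun_mix _ Dt _ _ aa ug; rewrite mulr_ge0.
have [ma _] := aa; have [mg _] := ug.
have mg1 := measurable_fun_fstX _ _ _ _ _ D D g mD mD mg.
have mg2 := measurable_fun_sndX _ _ _ _ _ D D g mD mD mg.
apply: measurable_funM => //; apply: measurable_funD; first exact: measurable_funM.
by apply: measurable_funM => //; exact: measurable_funB.
Qed.

(** * Accumulation of the error over the steps *)

Section perturbation.
Variables (a b : m.-tuple R -> m.-tuple R -> R) (kappa beta : R).
Hypotheses (aa : acceptance a) (ab : acceptance b).
Hypothesis kappa_gt0 : 0 < kappa.
Hypothesis a_minor : forall t t', D t -> D t' -> kappa <= h t t' * a t t'.
Hypothesis ab_dist : forall t t', D t -> D t' -> `|a t t' - b t t'| <= beta.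

Lemma unit_fun_iter_accept_op c n g : acceptance c -> unit_fun g ->
  unit_fun (iter n (accept_op c) g).
Proof. by move=> ac ug; elim: n => //= n IH; exact: unit_fun_accept_op. Qed.

(** Pointwise [kappa <= h * a <= h], and [h th] has mass one. This makes the contraction factor
    [1 - kappa * V] nonnegative. *)
Lemma kappa_volume_le1 th : D th -> kappa * V <= 1.
Proof.
move=> Dth.
rewrite -(LInt_const _ (ltW kappa_gt0)) -(h_int _ Dth).
apply: (le_LInt _ _ _ mD D_fin _ _ ch) => //; first exact: measurable_slice.
move=> t Dt; have /andP[h0 hC] := h_bnd _ _ Dth Dt; split=> //; first exact: ltW.
apply: le_trans (a_minor _ _ Dth Dt) _; rewrite ler_piMr//.
by have /andP[] := aa.2 _ _ Dth Dt.
Qed.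

Lemma oscillation_iter_accept_op n g : unit_fun g -> D !=set0 ->
  exists2 c, 0 <= c & forall t, D t ->
    c <= iter n (accept_op a) g t <= c + (1 - kappa * V) ^+ n.
Proof.
move=> ug [th Dth]; have q0 : 0 <= 1 - kappa * V.
  by rewrite subr_ge0; exact: kappa_volume_le1 Dth.
elim: n => [|n [c c0 IH]].
  by exists 0 => // t Dt; rewrite add0r expr0; exact: ug.2.
have [mf f01] := unit_fun_iter_accept_op _ n _ aa ug.
set f := iter n _ g in mf f01 IH *.
(* The lower end of the Doeblin interval for [r = (1 - kappa * V) ^+ n]; the upper end exceeds it by
   [r * (1 - kappa * V)]. *)
exists (kappa * LInt D f + c * (1 - kappa * V)).
  rewrite addr_ge0 ?mulr_ge0 ?(ltW kappa_gt0)//.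
  by apply: LInt_ge0 => t /f01/andP[].
move=> t Dt; rewrite iterS -/f.
have := accept_op_doeblin _ Dt _ _ _ _ kappa aa (conj mf f01) c0
  (exprn_ge0 n q0) IH (ltW kappa_gt0) (fun t' => a_minor _ _ Dt).
by rewrite exprS mulrDl addrA [(1 - _) ^+ n * _]mulrC.
Qed.

Lemma iter_accept_op_diff n g th : unit_fun g -> D th ->
  `|iter n (accept_op a) g th - iter n (accept_op b) g th| <= beta / (kappa * V).
Proof.
move=> ug Dth.
have V0 : 0 < V by apply: lt_le_trans (inv_le_volume _ Dth); rewrite invr_gt0.
have kV0 : 0 < kappa * V by exact: mulr_gt0.
have beta0 : 0 <= beta := le_trans (normr_ge0 _) (ab_dist _ _ Dth Dth).
have q0 : 0 <= 1 - kappa * V by rewrite subr_ge0; exact: kappa_volume_le1 Dth.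
(* The bound is the partial sum of [beta * (1 - kappa * V) ^+ j] over [j < k]; the uniform bound
   alone would not survive the induction. *)
suff geo k t : D t -> `|iter k (accept_op a) g t - iter k (accept_op b) g t|
    <= beta / (kappa * V) * (1 - (1 - kappa * V) ^+ k).
  apply: le_trans (geo n _ Dth) _; rewrite ler_piMr ?divr_ge0 ?(ltW kV0)//.
  by rewrite gerBl exprn_ge0.
elim: k t => [|k IH] t Dt; first by rewrite !iter0 subrr normr0 expr0 subrr mulr0.
have Dn : D !=set0 by exists th.
have [c c0 osc] := oscillation_iter_accept_op k g ug Dn.
rewrite !iterS.
have := accept_op_diff _ Dt _ _ _ _ _ _ beta _ aa ab
  (unit_fun_iter_accept_op _ k _ aa ug) (unit_fun_iter_accept_op _ k _ ab ug)
  (exprn_ge0 k q0) osc (fun t' => ab_dist _ _ Dt) IH.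
(* The new term [beta * (1 - kappa * V) ^+ k] extends the partial sum exactly, so the last
   comparison is an equality. *)
move=> /le_trans; apply; rewrite exprS le_eqVlt; apply/orP; left; apply/eqP.
by field; rewrite !gt_eqF.
Qed.

End perturbation.
End accept_reject_kernels.

(** * Mean deviation of an i.i.d. average *)

(** The sum of the squares of [x * u i - y * v i] is nonnegative. At [x = C], [y = A] it equals
    [A * (A * B - C ^+ 2)]; if [A] vanishes, so does every [u i]. *)
Lemma CauchySchwarz_sum (R : realType) (I : finType) (u v : I -> R) :
  (\sum_i u i * v i) ^+ 2 <= (\sum_i u i ^+ 2) * (\sum_i v i ^+ 2).
Proof.
set A := \sum_i u i ^+ 2; set B := \sum_i v i ^+ 2; set C := \sum_i u i * v i.
have A0 : 0 <= A by apply: sumr_ge0 => i _; exact: sqr_ge0.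
have P x y : 0 <= x ^+ 2 * A - x * y * C *+ 2 + y ^+ 2 * B.
  have -> : x ^+ 2 * A - x * y * C *+ 2 + y ^+ 2 * B =
      \sum_i (x * u i - y * v i) ^+ 2.
    rewrite /A /B /C -mulrnAl !mulr_sumr -sumrN -!big_split /=.
    by apply: eq_bigr => i _; ring.
  by apply: sumr_ge0 => i _; exact: sqr_ge0.
have [A1|A1] := eqVneq A 0.
  have C1 : C = 0.
    rewrite /C big1// => i _.
    have /eqP := A1; rewrite psumr_eq0 => [/allP/(_ i)|j _]; last exact: sqr_ge0.
    by rewrite mem_index_enum => /(_ isT) /=; rewrite sqrf_eq0 => /eqP ->; rewrite mul0r.
  by rewrite C1 A1 expr0n mul0r.
have := P C A.
have -> : C ^+ 2 * A - C * A * C *+ 2 + A ^+ 2 * B = A * (A * B - C ^+ 2) by ring.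
by rewrite pmulr_rge0 ?lt0r ?A1// subr_ge0.
Qed.

(** Cauchy-Schwarz for [sqrt p] and [sqrt p * |z|], the first having squares of sum one. *)
Lemma mean_abs_le_sqrt (R : realType) (I : finType) (p z : I -> R) :
  (forall i, 0 <= p i) -> \sum_i p i = 1 ->
  \sum_i p i * `|z i| <= Num.sqrt (\sum_i p i * z i ^+ 2).
Proof.
move=> p0 p1.
have S0 : 0 <= \sum_i p i * `|z i| by apply: sumr_ge0 => i _; rewrite mulr_ge0.
rewrite -[leLHS]ger0_norm// -sqrtr_sqr ler_wsqrtr//.
have := CauchySchwarz_sum _ _ (fun i => Num.sqrt (p i)) (fun i => Num.sqrt (p i) * `|z i|).
under eq_bigr do rewrite mulrA -expr2 sqr_sqrtr//.
under [X in _ <= X * _]eq_bigr do rewrite sqr_sqrtr//.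
under [X in _ <= _ * X]eq_bigr do rewrite exprMn sqr_sqrtr// real_normK ?num_real//.
by rewrite p1 mul1r.
Qed.

(** The factor may depend on the coordinate, so that cross moments, which single out two
    coordinates, are covered as well as the total mass. *)
Lemma sum_tuple_prod (R : realType) (I : finType) N (F : 'I_N -> I -> R) :
  \sum_(t : N.-tuple I) \prod_(i < N) F i (tnth t i) = \prod_(i < N) \sum_x F i x.
Proof.
rewrite bigA_distr_bigA (reindex (fun f : {ffun 'I_N -> I} => [tuple f i | i < N])) /=.
  by apply: eq_bigr => f _; apply: eq_bigr => i _; rewrite tnth_mktuple.
exists (fun t : N.-tuple I => [ffun i => tnth t i]) => [f _|t _].
  by apply/ffunP => i; rewrite ffunE tnth_mktuple.
by apply: eq_from_tnth => i; rewrite tnth_mktuple ffunE.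
Qed.

Section iid_sample.
Variables (R : realType) (I : finType) (N : nat) (p z : I -> R).
Hypotheses (p1 : \sum_x p x = 1) (z0 : \sum_x p x * z x = 0).

Lemma iid_mass : \sum_(t : N.-tuple I) \prod_(i < N) p (tnth t i) = 1.
Proof. by rewrite (sum_tuple_prod _ _ _ (fun=> p)) big1. Qed.

(** Independence: the sum factors over the coordinates. For [j != k] the factor at [j] is the mean
    of [z], hence zero; for [j = k] the only factor other than one is the second moment. *)
Lemma iid_cross (j k : 'I_N) :
  \sum_(t : N.-tuple I) (\prod_(i < N) p (tnth t i)) * (z (tnth t j) * z (tnth t k))
  = (j == k)%:R * \sum_x p x * z x ^+ 2.
Proof.
pose F i x := p x * ((if i == j then z x else 1) * (if i == k then z x else 1)).
transitivity (\prod_(i < N) \sum_x F i x).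
  rewrite -sum_tuple_prod; apply: eq_bigr => t _; rewrite /F !big_split /=.
  congr (_ * (_ * _)).
    by rewrite (bigD1 j)//= eqxx big1 ?mulr1// => i /negbTE ->.
  by rewrite (bigD1 k)//= eqxx big1 ?mulr1// => i /negbTE ->.
have [jk|jk] := eqVneq j k.
  rewrite mul1r (bigD1 k)//= [X in _ * X]big1 => [|i /negbTE ik].
    by rewrite mulr1; apply: eq_bigr => x _; rewrite /F jk eqxx expr2.
  by rewrite -[RHS]p1; apply: eq_bigr => x _; rewrite /F jk ik !mulr1.
rewrite mul0r (bigD1 j)//= [X in X * _](_ : _ = 0) ?mul0r//.
by rewrite -[RHS]z0; apply: eq_bigr => x _; rewrite /F eqxx (negbTE jk) mulr1.
Qed.

Lemma iid_second_moment :
  \sum_(t : N.-tuple I) (\prod_(i < N) p (tnth t i)) * (\sum_(i < N) z (tnth t i)) ^+ 2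
  = N%:R * \sum_x p x * z x ^+ 2.
Proof.
under eq_bigr do rewrite expr2 big_distrlr mulr_sumr.
rewrite exchange_big /=.
under eq_bigr do under eq_bigr do rewrite mulr_sumr.
under eq_bigr do rewrite exchange_big.
under eq_bigr do under eq_bigr do rewrite iid_cross.
under eq_bigr => j _.
  rewrite (bigD1 j)//= eqxx mul1r [X in _ + X]big1 ?addr0; first over.
  by move=> k; rewrite eq_sym => /negbTE ->; rewrite mul0r.
by rewrite sumr_const card_ord mulr_natl.
Qed.

(** The mean absolute value is at most the root mean square, and the second moment of the average is
    [N^-2 * N] times that of [z]. *)
Lemma iid_mean_abs_dev : (forall x, 0 <= p x) -> (0 < N)%N ->
  \sum_(t : N.-tuple I) (\prod_(i < N) p (tnth t i))
     * `|N%:R^-1 * \sum_(i < N) z (tnth t i)|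
  <= Num.sqrt (\sum_x p x * z x ^+ 2) / Num.sqrt N%:R.
Proof.
move=> p0 N0; have N1 : 0 < N%:R :> R by rewrite ltr0n.
apply: (le_trans (mean_abs_le_sqrt _ _ _ _ _ iid_mass)).
  by move=> t; apply: prodr_ge0.
under eq_bigr do rewrite exprMn mulrCA.
rewrite -mulr_sumr iid_second_moment.
set S := \sum_x _.
have -> : N%:R^-1 ^+ 2 * (N%:R * S) = N%:R^-1 * S by field; rewrite gt_eqF.
by rewrite sqrtrM ?invr_ge0 ?(ltW N1)// sqrtrV ?(ltW N1)// mulrC.
Qed.

End iid_sample.

(** * Gibbs likelihoods with bounded parameters *)

Lemma normr_dotv_le (R : realType) m (u v : vec R m) :
  `|dotv u v| <= normv u * normv v.
Proof.
rewrite /normv -sqrtrM; last by apply: sumr_ge0 => i _; rewrite -expr2 sqr_ge0.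
rewrite -sqrtr_sqr ler_wsqrtr//.
exact: (CauchySchwarz_sum R 'I_m (tnth u) (tnth v)).
Qed.

Lemma ratio_bnd (R : realFieldType) (c a b : R) :
  0 < c -> c^-1 <= a <= c -> c^-1 <= b <= c -> c^-1 ^+ 2 <= a / b <= c ^+ 2.
Proof.
move=> c0 /andP[a0 a1] /andP[b0 b1].
have ci : 0 < c^-1 by rewrite invr_gt0.
have bp : 0 < b := lt_le_trans ci b0.
have vb : b^-1 <= c by rewrite -(invrK c) lef_pV2 ?posrE.
have vb' : c^-1 <= b^-1 by rewrite lef_pV2 ?posrE.
rewrite !expr2; apply/andP; split; apply: ler_pM => //; rewrite ?ltW// ?invr_gt0//.
exact: lt_le_trans a0.
Qed.

Lemma min1_lipschitz (R : realDomainType) (a b : R) :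
  `|Num.min 1 a - Num.min 1 b| <= `|a - b|.
Proof.
wlog ab : a b / a <= b => [H|].
  by have [/H//|/ltW/H] := leP a b; rewrite distrC [leRHS]distrC.
rewrite ler_distl /Num.min.
have : `|a - b| = b - a by rewrite distrC ger0_norm ?subr_ge0.
by move=> ->; case: (ltP 1 a) => ?; case: (ltP 1 b) => ?; apply/andP; split; lra.
Qed.

(** On positive reals inversion is [expR (- ln x)], a composition of measurable functions. *)
Lemma measurable_fun_invr (R : realType) d (T : measurableType d) (A : set T)
    (f : T -> R) : measurable_fun A f -> (forall x, A x -> 0 < f x) ->
  measurable_fun A (fun x => (f x)^-1).
Proof.
move=> mf f0; apply: (eq_measurable_fun (fun x => expR (- ln (f x)))).
  by move=> x /set_mem Ax; rewrite expRN lnK// posrE f0.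
apply: measurableT_comp; first exact: measurable_expR.
by apply: measurableT_comp => //; apply: measurableT_comp => //; exact: measurable_ln.
Qed.

Section gibbs.
Variables (R : realType) (m : nat) (Y : finType) (s : Y -> vec R m).

Lemma qf_gt0 t x : 0 < qf s t x. Proof. exact: expR_gt0. Qed.

Lemma Zf_gt0 (y : Y) t : 0 < Zf s t.
Proof.
by rewrite /Zf (bigD1 y)//= ltr_pwDl ?qf_gt0// sumr_ge0// => x _; rewrite ltW// qf_gt0.
Qed.

Lemma lik_ge0 t x : 0 <= lik s t x.
Proof. by rewrite divr_ge0 ?ltW ?qf_gt0// (Zf_gt0 x). Qed.

Lemma sum_lik (y : Y) t : \sum_x lik s t x = 1.
Proof. by rewrite -mulr_suml divff// gt_eqF// (Zf_gt0 y). Qed.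

(* Unbiasedness of the importance sampling estimator of [Z(t) / Z(t')]. *)
Lemma mean_lik_ratio t t' : mean_lik s t' (fun x => qf s t x / qf s t' x) = Zf s t / Zf s t'.
Proof.
rewrite /mean_lik [Zf s t]/Zf mulr_suml; apply: eq_bigr => x _.
by rewrite /lik; field; rewrite !gt_eqF ?(Zf_gt0 x) ?qf_gt0.
Qed.

(** The variance is the second moment minus the squared mean. The point [y] shows [Y] inhabited, so
    that the likelihood has total mass one. *)
Lemma var_lik_le (y : Y) t (r : Y -> R) C :
  (forall x, 0 <= r x <= C) -> var_lik s t r <= C ^+ 2.
Proof.
move=> rC; set mu := mean_lik s t r.
have -> : var_lik s t r = \sum_x lik s t x * r x ^+ 2 - mu ^+ 2.
  rewrite /var_lik /mean_lik -/(mean_lik s t r) -/mu.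
  transitivity (\sum_x (lik s t x * r x ^+ 2 + - (mu *+ 2) * (lik s t x * r x)
      + mu ^+ 2 * lik s t x)); first by apply: eq_bigr => x _; ring.
  rewrite !big_split /= -!mulr_sumr sum_lik// -/(mean_lik s t r) -/mu; ring.
rewrite lerBlDr ler_wpDr ?sqr_ge0//.
rewrite -[leRHS]mul1r -(sum_lik y t) mulr_suml; apply: ler_sum => x _.
by have /andP[r0 r1] := rC x; rewrite ler_wpM2l ?lik_ge0// lerXn2r// nnegrE// (le_trans r0).
Qed.

(** * Uniform bounds over a bounded parameter set *)

Variables (Theta : set (vec R m)).
Hypothesis Theta_bnd : exists M : R, forall t, Theta t -> normv t <= M.

Let T := sup [set normv t | t in Theta].
Let K := expR (T * Sconst s).

Let normv_le_T t : Theta t -> normv t <= T.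
Proof.
move=> Tt; apply: ub_le_sup; last by exists t.
by have [M HM] := Theta_bnd; exists M => _ [u /HM ? <-].
Qed.

(** By Cauchy-Schwarz the exponent has absolute value at most [T * Sconst s]. *)
Lemma qf_bnd t x : Theta t -> K^-1 <= qf s t x <= K.
Proof.
move=> Tt; rewrite /K -expRN !ler_expR -ler_norml.
apply: le_trans (normr_dotv_le _ _ _ _) _; apply: ler_pM.
- exact: sqrtr_ge0.
- exact: sqrtr_ge0.
- exact: normv_le_T.
- by rewrite /Sconst; apply: (le_bigmax _ (fun x => normv (s x))).
Qed.

Lemma qf_ratio_bnd t t' x x' : Theta t -> Theta t' ->
  K^-1 ^+ 2 <= qf s t x / qf s t' x' <= K ^+ 2.
Proof. by move=> Tt Tt'; apply: ratio_bnd; [exact: expR_gt0|exact: qf_bnd|exact: qf_bnd]. Qed.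

(** The lower bound on the ratio of weights holds for each [x], so it passes to the sums. *)
Lemma Zf_ratio_ge (y : Y) t t' : Theta t -> Theta t' -> K^-1 ^+ 2 <= Zf s t / Zf s t'.
Proof.
move=> Tt Tt'; rewrite ler_pdivlMr ?(Zf_gt0 y)// /Zf mulr_sumr.
apply: ler_sum => x _; rewrite -ler_pdivlMr ?qf_gt0//.
by have /andP[] := qf_ratio_bnd _ _ x x Tt Tt'.
Qed.

Variables (y : Y) (pi : vec R m -> R) (h : vec R m -> vec R m -> R) (c_pi c_h : R).
Hypotheses (c_pi0 : 0 < c_pi) (c_h0 : 0 < c_h).
Hypothesis pi_bnd : forall t, Theta t -> c_pi^-1 <= pi t <= c_pi.
Hypothesis h_bnd : forall t t', Theta t -> Theta t' -> c_h^-1 <= h t t' <= c_h.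

(** The factor common to [alpha] and [alpha_hat], which differ only in the ratio of normalising
    constants and its estimate. *)
Definition MH_prefactor t t' := (qf s t' y * pi t' * h t' t) / (qf s t y * pi t * h t t').
(** This constant serves twice: [Dc / sqrt N] bounds the mean error of [alpha_hat], and [Dc^-1]
    bounds [alpha] from below. *)
Let Dc := c_h ^+ 2 * c_pi ^+ 2 * K ^+ 4.

Let K0 : 0 < K. Proof. exact: expR_gt0. Qed.

Let Dc0 : 0 < Dc. Proof. by rewrite !mulr_gt0 ?exprn_gt0. Qed.

Let lower_ge0 : 0 <= c_h^-1 ^+ 2 * c_pi^-1 ^+ 2 * K^-1 ^+ 2.
Proof. by rewrite -!exprMn; exact: sqr_ge0. Qed.

Let h_gt0 t t' : Theta t -> Theta t' -> 0 < h t t'.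
Proof.
by move=> Tt Tt'; have /andP[+ _] := h_bnd _ _ Tt Tt'; apply: lt_le_trans; rewrite invr_gt0.
Qed.

Let pi_gt0 t : Theta t -> 0 < pi t.
Proof. by move=> Tt; have /andP[+ _] := pi_bnd _ Tt; apply: lt_le_trans; rewrite invr_gt0. Qed.

Lemma MH_prefactor_bnd t t' : Theta t -> Theta t' ->
  c_h^-1 ^+ 2 * c_pi^-1 ^+ 2 * K^-1 ^+ 2 <= MH_prefactor t t' <= c_h ^+ 2 * c_pi ^+ 2 * K ^+ 2.
Proof.
move=> Tt Tt'.
have -> : MH_prefactor t t' = (h t' t / h t t') * (pi t' / pi t) * (qf s t' y / qf s t y).
  rewrite /MH_prefactor; field.
  by rewrite !gt_eqF ?qf_gt0 ?pi_gt0 ?h_gt0.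
have /andP[h1 h2] := ratio_bnd _ _ _ _ c_h0 (h_bnd _ _ Tt' Tt) (h_bnd _ _ Tt Tt').
have /andP[p1 p2] := ratio_bnd _ _ _ _ c_pi0 (pi_bnd _ Tt') (pi_bnd _ Tt).
have /andP[q1 q2] := qf_ratio_bnd _ _ y y Tt' Tt.
have e1 := sqr_ge0 c_h^-1; have e2 := sqr_ge0 c_pi^-1; have e3 := sqr_ge0 K^-1.
apply/andP; split.
  by apply: ler_pM => //; [exact: mulr_ge0|exact: ler_pM].
have h3 := le_trans e1 h1; have p3 := le_trans e2 p1; have q3 := le_trans e3 q1.
by apply: ler_pM => //; [exact: mulr_ge0|exact: ler_pM].
Qed.

Lemma alpha_ge t t' : Theta t -> Theta t' -> Dc^-1 <= alpha s pi h y t t'.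
Proof.
move=> Tt Tt'; rewrite /alpha -/(MH_prefactor t t').
have /andP[p1 p2] := MH_prefactor_bnd _ _ Tt Tt'.
have z1 := Zf_ratio_ge y _ _ Tt Tt'.
have -> : Dc^-1 = c_h^-1 ^+ 2 * c_pi^-1 ^+ 2 * K^-1 ^+ 2 * K^-1 ^+ 2.
  by rewrite /Dc; field; rewrite !gt_eqF.
by apply: ler_pM => //; exact: sqr_ge0.
Qed.

Lemma sqrt_var_ratio_le t t' : Theta t -> Theta t' ->
  Num.sqrt (var_lik s t' (fun x => qf s t x / qf s t' x)) <= K ^+ 2.
Proof.
move=> Tt Tt'; rewrite -[leRHS]ger0_norm ?sqr_ge0// -sqrtr_sqr ler_wsqrtr//.
apply: (var_lik_le y) => x; have /andP[_ ->] := qf_ratio_bnd _ _ x x Tt Tt'.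
by rewrite divr_ge0 ?ltW ?qf_gt0.
Qed.

(** Of the power [K ^+ 4], one square comes from the prefactor and one from the standard deviation
    of the importance ratio. *)
Lemma delta_bnd N t t' : Theta t -> Theta t' ->
  MH_prefactor t t' * (Num.sqrt (var_lik s t' (fun x => qf s t x / qf s t' x)) / Num.sqrt N%:R)
    <= Dc / Num.sqrt N%:R.
Proof.
move=> Tt Tt'; have /andP[p1 p2] := MH_prefactor_bnd _ _ Tt Tt'.
have -> : Dc = c_h ^+ 2 * c_pi ^+ 2 * K ^+ 2 * K ^+ 2 by rewrite /Dc; ring.
rewrite mulrA ler_wpM2r ?invr_ge0 ?sqrtr_ge0//.
rewrite ler_pM ?sqrtr_ge0 ?sqrt_var_ratio_le//; apply: le_trans p1.
exact: lower_ge0.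
Qed.

Lemma sum_iid_prob N t : \sum_(y' : N.-tuple Y) iid_prob s t y' = 1.
Proof. exact: (iid_mass _ _ _ _ (sum_lik y t)). Qed.

Lemma iid_prob_ge0 N t (y' : N.-tuple Y) : 0 <= iid_prob s t y'.
Proof. by apply: prodr_ge0 => i _; exact: lik_ge0. Qed.

(** By unbiasedness, [alpha_hat - alpha] is the prefactor times the average of the centred
    importance ratios [z], to which the i.i.d. deviation bound applies. *)
Lemma alpha_hat_mean_dist N t t' : (0 < N)%N -> Theta t -> Theta t' ->
  \sum_(y' : N.-tuple Y) iid_prob s t' y' *
    `|alpha_hat s pi h y t t' y' - alpha s pi h y t t'| <= Dc / Num.sqrt N%:R.
Proof.
move=> N0 Tt Tt'; set r := fun x => qf s t x / qf s t' x.
set mu := mean_lik s t' r; pose z x := r x - mu.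
have z0 : \sum_x lik s t' x * z x = 0.
  rewrite /z; under eq_bigr do rewrite mulrBr.
  by rewrite sumrB -mulr_suml (sum_lik y) mul1r subrr.
have N1 : N%:R != 0 :> R by rewrite pnatr_eq0 -lt0n.
have p0 : 0 <= MH_prefactor t t'.
  have /andP[p1 _] := MH_prefactor_bnd _ _ Tt Tt'; apply: le_trans p1.
  exact: lower_ge0.
apply: le_trans (delta_bnd N _ _ Tt Tt').
have dev := iid_mean_abs_dev _ _ _ _ _ (sum_lik y t') z0 (lik_ge0 t') N0.
apply: le_trans (ler_wpM2l p0 dev); rewrite mulr_sumr; apply: ler_sum => y' _.
rewrite /iid_prob mulrCA; apply: ler_wpM2l; first exact: iid_prob_ge0.
rewrite /alpha_hat /alpha -/(MH_prefactor t t') -mulrBr normrM (ger0_norm p0) ler_wpM2l//.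
rewrite /z sumrB sumr_const card_ord mulrBr -(mulr_natl mu) mulKf//.
by rewrite /mu mean_lik_ratio.
Qed.
End gibbs.

(** * The exact and the noisy exchange kernels *)

Section exchange_kernels.
Variables (R : realType) (m : nat) (Y : finType) (s : Y -> vec R m).

Lemma measurable_qf x : measurable_fun setT (fun t : m.-tuple R => qf s t x).
Proof.
apply: measurableT_comp; first exact: measurable_expR.
apply: measurable_sum => i; apply: measurable_funM => //.
exact: measurable_tnth.
Qed.

Lemma measurable_Zf : measurable_fun setT (fun t : m.-tuple R => Zf s t).
Proof. by apply: measurable_sum => x; exact: measurable_qf. Qed.

Lemma measurable_lik x : measurable_fun setT (fun t : m.-tuple R => lik s t x).
Proof.
apply: measurable_funM; first exact: measurable_qf.
by apply: measurable_fun_invr => [|t _]; [exact: measurable_Zf|exact: Zf_gt0].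
Qed.

Variables (y : Y) (pi : m.-tuple R -> R) (h : m.-tuple R -> m.-tuple R -> R).
Variables (Theta : set (m.-tuple R)).
Hypotheses (mTheta : measurable Theta) (mpi : measurable_fun Theta pi).
Hypothesis mh : measurable_fun (Theta `*` Theta) (fun p => h p.1 p.2).
Hypothesis pi_gt0 : forall t, Theta t -> 0 < pi t.
Hypothesis h_gt0 : forall t t', Theta t -> Theta t' -> 0 < h t t'.
Hypothesis h_int : forall t, Theta t -> LInt Theta (h t) = 1.

Let mfst (f : m.-tuple R -> R) : measurable_fun setT f ->
  measurable_fun (Theta `*` Theta) (fun p => f p.1).
Proof. by move=> mf; apply: measurable_fun_fstX => //; exact: measurable_funTS. Qed.

Let msnd (f : m.-tuple R -> R) : measurable_fun setT f ->
  measurable_fun (Theta `*` Theta) (fun p => f p.2).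
Proof. by move=> mf; apply: measurable_fun_sndX => //; exact: measurable_funTS. Qed.

Let MH_prefactor_gt0 t t' : Theta t -> Theta t' -> 0 < MH_prefactor _ _ _ s y pi h t t'.
Proof.
by move=> Tt Tt'; rewrite divr_gt0// !mulr_gt0 ?qf_gt0 ?pi_gt0 ?h_gt0.
Qed.

Let measurable_MH_prefactor : measurable_fun (Theta `*` Theta)
  (fun p => MH_prefactor _ _ _ s y pi h p.1 p.2).
Proof.
have mq := measurable_qf y.
have mh' : measurable_fun (Theta `*` Theta) (fun p => h p.2 p.1).
  apply: (measurable_comp (F := Theta `*` Theta) (f := fun p => h p.1 p.2) (g := fun p => (p.2, p.1))) => //.
  - exact: measurableX.
  - by move=> _ [[? ?] [? ?] <-].
  - by apply: measurable_funTS; exact: measurable_fun_pair.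
apply: measurable_funM.
  apply: measurable_funM => //; apply: measurable_funM; first exact: msnd mq.
  exact: measurable_fun_sndX.
apply: measurable_fun_invr => [|[t t'] [/= Tt Tt']].
  apply: measurable_funM => //; apply: measurable_funM; first exact: mfst mq.
  exact: measurable_fun_fstX.
by rewrite !mulr_gt0 ?qf_gt0 ?pi_gt0 ?h_gt0.
Qed.

Let min1_unit (x : R) : 0 <= x -> 0 <= Num.min 1 x <= 1.
Proof. by move=> x0; rewrite le_min ler01 x0 ge_min lexx. Qed.

Definition MH_acceptance t t' := Num.min 1 (alpha s pi h y t t').

(** Averaging over the auxiliary sample turns the noisy kernel into an accept/reject kernel with a
    deterministic acceptance probability. *)
Definition noisy_acceptance N t t' :=
  \sum_(y' : N.-tuple Y) iid_prob s t' y' * Num.min 1 (alpha_hat s pi h y t t' y').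

Lemma acceptance_MH : acceptance R m Theta MH_acceptance.
Proof.
split=> [|t t' Tt Tt']; last first.
  apply: min1_unit; rewrite /alpha -/(MH_prefactor _ _ _ s y pi h t t').
  by rewrite mulr_ge0 ?(ltW (MH_prefactor_gt0 _ _ Tt Tt'))// divr_ge0// ltW// (Zf_gt0 _ _ _ _ y).
apply: measurable_minr => //; apply: measurable_funM => //; apply: measurable_funM.
  exact: mfst measurable_Zf.
apply: measurable_fun_invr => [|p _]; last exact: Zf_gt0.
exact: msnd measurable_Zf.
Qed.

Lemma acceptance_noisy N : acceptance R m Theta (noisy_acceptance N).
Proof.
split=> [|t t' Tt Tt'].
  apply: measurable_sum => y'; apply: measurable_funM.
    apply: (msnd (fun t => iid_prob s t y')).
    by apply: measurable_prod => i _; exact: measurable_lik.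
  apply: measurable_minr => //; apply: measurable_funM => //; apply: measurable_funM => //.
  apply: measurable_sum => i; apply: measurable_funM; first exact: mfst (measurable_qf _).
  by apply: measurable_fun_invr => [|p _]; [exact: msnd (measurable_qf _)|exact: qf_gt0].
have a01 (y' : N.-tuple Y) : 0 <= Num.min 1 (alpha_hat s pi h y t t' y') <= 1.
  apply: min1_unit; rewrite /alpha_hat -/(MH_prefactor _ _ _ s y pi h t t').
  rewrite mulr_ge0 ?(ltW (MH_prefactor_gt0 _ _ Tt Tt'))// mulr_ge0 ?invr_ge0//.
  by apply: sumr_ge0 => i _; rewrite divr_ge0// ltW// qf_gt0.
apply/andP; split.
  by apply: sumr_ge0 => y' _; rewrite mulr_ge0 ?iid_prob_ge0//; have /andP[] := a01 y'.
rewrite -(sum_iid_prob _ _ _ s y N t'); apply: ler_sum => y' _.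
by rewrite ler_piMr ?iid_prob_ge0//; have /andP[] := a01 y'.
Qed.

(** As [iid_prob] has mass one, the exact acceptance is its own average over the samples; the claim
    follows termwise because [min 1] is 1-Lipschitz. *)
Lemma acceptance_dist N t t' :
  `|MH_acceptance t t' - noisy_acceptance N t t'| <=
  \sum_(y' : N.-tuple Y) iid_prob s t' y' *
    `|alpha_hat s pi h y t t' y' - alpha s pi h y t t'|.
Proof.
rewrite distrC -[MH_acceptance t t']mul1r -(sum_iid_prob _ _ _ s y N t') mulr_suml -sumrB.
apply: le_trans (ler_norm_sum _ _ _) _; apply: ler_sum => y' _.
rewrite -mulrBr normrM ger0_norm ?iid_prob_ge0//.
by apply: ler_wpM2l; [exact: iid_prob_ge0|exact: min1_lipschitz].
Qed.

(** The move is affine in the acceptance probability, so the sum over samples passes onto it.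
    Agreement of [f] and [g] is asked on [Theta] only, which is what an induction on iterates
    provides. *)
Lemma noisy_opE N f g th : (forall t, Theta t -> f t = g t) -> Theta th ->
  noisy_op s pi h y Theta N f th = accept_op R m Theta h (noisy_acceptance N) g th.
Proof.
move=> fg Tth; apply: LInt_eq => t Tt; congr (_ * _).
rewrite (fg _ Tt) (fg _ Tth).
under eq_bigr do rewrite mulrDr !mulrA mulrBr mulr1.
by rewrite big_split /= -!mulr_suml sumrB sum_iid_prob.
Qed.

Variable ch : R.
Hypothesis Theta_fin : (leb_measure Theta < +oo)%E.
Hypothesis h_le : forall t t', Theta t -> Theta t' -> 0 <= h t t' <= ch.

Lemma MH_opE f g th : (forall t, Theta t -> f t = g t) -> unit_fun R m Theta g ->
  Theta th -> MH_op s pi h y Theta f th = accept_op R m Theta h MH_acceptance g th.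
Proof.
move=> fg [mg g01] Tth; have [ma a01] := acceptance_MH.
have mhth : measurable_fun Theta (h th) by exact: measurable_slice mTheta mh Tth.
have math : measurable_fun Theta (MH_acceptance th) by exact: measurable_slice mTheta ma Tth.
have hu u t : Theta t -> 0 <= u <= 1 -> 0 <= h th t * u <= ch.
  move=> Tt /andP[u0 u1]; have /andP[h0 hC] := h_le _ _ Tth Tt.
  by rewrite mulr_ge0//= (le_trans _ hC)// ler_piMr.
have b01 t : Theta t -> 0 <= 1 - MH_acceptance th t <= 1.
  by move=> /(a01 _ _ Tth)/andP[? ?]; apply/andP; split; lra.
have mb : measurable_fun Theta (fun t => h th t * (1 - MH_acceptance th t)).
  by apply: measurable_funM => //; exact: measurable_funB.
have /andP[gth0 gth1] := g01 _ Tth.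
(* Writing 1 as the mass of [h th] moves the rejection probability, which [MH_op] keeps outside the
   integral, under it. *)
have stay : 1 - LInt Theta (fun t => h th t * MH_acceptance th t) =
    LInt Theta (fun t => h th t * (1 - MH_acceptance th t)).
  rewrite -[X in X - _](h_int _ Tth); apply/eqP; rewrite subr_eq; apply/eqP.
  rewrite -(LIntD _ _ _ mTheta Theta_fin _ _ ch) //.
  - by apply: LInt_eq => t _; ring.
  - by move=> t Tt; apply: hu => //; exact: b01.
  - exact: measurable_funM.
  - by move=> t Tt; apply: hu => //; exact: a01.
rewrite /MH_op -/(MH_acceptance th) stay (fg _ Tth) mulrC.
rewrite -(LIntZl _ _ _ mTheta Theta_fin _ ch)//; last first.
  by move=> t Tt; apply: hu => //; exact: b01.
have ag01 t : Theta t -> 0 <= MH_acceptance th t * g t <= 1.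
  move=> Tt; have /andP[a0 a1] := a01 _ _ Tth Tt; have /andP[g0 g1] := g01 _ Tt.
  by rewrite mulr_ge0//= mulr_ile1.
have -> : LInt Theta (fun t => h th t * Num.min 1 (alpha s pi h y th t) * f t) =
    LInt Theta (fun t => h th t * (MH_acceptance th t * g t)).
  by apply: LInt_eq => t Tt; rewrite (fg _ Tt) -mulrA.
rewrite -(LIntD _ _ _ mTheta Theta_fin _ _ ch).
- by apply: LInt_eq => t _; ring.
- exact: measurable_funM.
- move=> t Tt; rewrite mulrCA; apply: hu => //; have /andP[b0 b1] := b01 _ Tt.
  by rewrite mulr_ge0//= mulr_ile1.
- by apply: measurable_funM => //; exact: measurable_funM.
- by move=> t Tt; apply: hu => //; exact: ag01.
Qed.

Lemma iter_MH_opE n g th : unit_fun R m Theta g -> Theta th ->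
  iter n (MH_op s pi h y Theta) g th = iter n (accept_op R m Theta h MH_acceptance) g th.
Proof.
move=> ug; elim: n th => // n IH th Tth; rewrite !iterS; apply: MH_opE => //.
exact: (unit_fun_iter_accept_op _ _ _ _ ch mTheta Theta_fin mh h_le h_int _ _ _ acceptance_MH).
Qed.

Lemma iter_noisy_opE N n g th : Theta th ->
  iter n (noisy_op s pi h y Theta N) g th =
  iter n (accept_op R m Theta h (noisy_acceptance N)) g th.
Proof. by elim: n th => // n IH th Tth; rewrite !iterS; exact: noisy_opE. Qed.

End exchange_kernels.

Theorem theorem3 (R : realType) :
  exists Cst : R -> R -> R -> R,
  forall (m : nat) (Y : finType) (s : Y -> vec R m)
    (Theta : set (vec R m)) (y : Y)
    (pi : vec R m -> R) (h : vec R m -> vec R m -> R) (c_pi c_h : R) (N : nat),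
    (* Theta bounded, measurable, of positive Lebesgue measure *)
    measurable Theta ->
    (exists M : R, forall t, Theta t -> normv t <= M) ->
    (0 < leb_measure Theta)%E ->
    (* pi is a probability density on Theta *)
    measurable_fun Theta pi ->
    LInt Theta pi = 1 ->
    (* h(.|th) is a probability density on Theta, jointly measurable *)
    measurable_fun (Theta `*` Theta) (fun p : vec R m * vec R m => h p.1 p.2) ->
    (forall t, Theta t -> LInt Theta (h t) = 1) ->
    (* (A1) and (A2) *)
    0 < c_pi -> (forall t, Theta t -> c_pi^-1 <= pi t <= c_pi) ->
    0 < c_h -> (forall t t', Theta t -> Theta t' -> c_h^-1 <= h t t' <= c_h) ->
    (1 <= N)%N ->
    let K := expR (sup [set normv t | t in Theta] * Sconst s) in
    (forall t t', Theta t -> Theta t' ->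
       (Num.sqrt (N%:R : R))^-1 *
         ((h t' t * pi t' * qf s t' y) / (h t t' * pi t * qf s t y) *
          Num.sqrt (var_lik s t' (fun x => qf s t x / qf s t' x)))
         <= c_h ^+ 2 * c_pi ^+ 2 * K ^+ 4 / Num.sqrt N%:R
       /\
       \sum_(y' : N.-tuple Y) iid_prob s t' y' *
          `|alpha_hat s pi h y t t' y' - alpha s pi h y t t'|
         <= c_h ^+ 2 * c_pi ^+ 2 * K ^+ 4 / Num.sqrt N%:R)
    /\
    (forall (n : nat) (th0 : vec R m) (A : set (vec R m)),
       Theta th0 -> measurable A ->
       `|law_after (MH_op s pi h y Theta) n th0 A
         - law_after (noisy_op s pi h y Theta N) n th0 A|
         <= Cst c_pi c_h K / Num.sqrt N%:R).
Proof.
(* The perturbation bound is [(Dc / sqrt N) / (kappa * V)]; with [kappa = (c_h * Dc)^-1] and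
   [V >= c_h^-1] it is at most [c_h ^+ 2 * Dc ^+ 2 / sqrt N]. *)
exists (fun c_pi c_h K => c_h ^+ 2 * (c_h ^+ 2 * c_pi ^+ 2 * K ^+ 4) ^+ 2).
move=> m Y s Theta y pi h c_pi c_h N mTheta Theta_bnd _ mpi _ mh h_int c_pi0 pi_bnd
  c_h0 h_bnd N1 K.
set Dc := c_h ^+ 2 * c_pi ^+ 2 * K ^+ 4.
have Dc0 : 0 < Dc by rewrite !mulr_gt0 ?exprn_gt0 ?expR_gt0.
have dist t t' (Tt : Theta t) (Tt' : Theta t') := alpha_hat_mean_dist _ _ _ s _ Theta_bnd
  y _ _ _ _ c_pi0 c_h0 pi_bnd h_bnd N _ _ N1 Tt Tt'.
split=> [t t' Tt Tt'|n th0 A Tth0 mA].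
  split; last exact: dist.
  have := delta_bnd _ _ _ s _ Theta_bnd y _ _ _ _ c_pi0 c_h0 pi_bnd h_bnd N _ _ Tt Tt'.
  have perm3 (a b c : R) : a * b * c = c * b * a by ring.
  by rewrite /MH_prefactor (perm3 (qf _ _ _)) (perm3 (qf s t y)) mulrA [X in X <= _]mulrC.
have ci0 : 0 < c_h^-1 by rewrite invr_gt0.
have h_gt0 t t' : Theta t -> Theta t' -> 0 < h t t'.
  by move=> Tt Tt'; have /andP[/(lt_le_trans ci0)] := h_bnd _ _ Tt Tt'.
have pi_gt0 t : Theta t -> 0 < pi t.
  by move=> Tt; have /andP[+ _] := pi_bnd _ Tt; apply: lt_le_trans; rewrite invr_gt0.
have h_le t t' : Theta t -> Theta t' -> 0 <= h t t' <= c_h.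
  by move=> Tt Tt'; rewrite ltW ?h_gt0//; have /andP[] := h_bnd _ _ Tt Tt'.
have mhth0 := measurable_slice _ _ _ _ _ mTheta mh Tth0.
have Theta_fin : (leb_measure Theta < +oo)%E.
  apply: (leb_measure_lty _ _ _ mTheta _ _ c_h0 mhth0 _ (h_int _ Tth0)) => t Tt.
  by have /andP[] := h_bnd _ _ Tth0 Tt.
have u1A : unit_fun R m Theta (fun t => \1_A t).
  split=> [|t _]; first exact: measurable_indic.
  by rewrite indicE; case: (t \in A); rewrite ?lexx ?ler01.
(* At equal arguments [alpha] is 1, and it is at least [Dc^-1]. Hence [Dc^-1] also bounds
   [min 1 alpha] from below. *)
have Dc1 : 1 <= Dc.
  have a_ge := alpha_ge _ _ _ s _ Theta_bnd y _ _ _ _ c_pi0 c_h0 pi_bnd h_bnd _ _ Tth0 Tth0.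
  have a1 : alpha s pi h y th0 th0 = 1.
    rewrite /alpha !divff ?mulr1// !gt_eqF ?(Zf_gt0 _ _ _ _ y)//.
    by rewrite !mulr_gt0 ?qf_gt0 ?pi_gt0 ?h_gt0.
  by move: a_ge; rewrite a1 -/K -/Dc invf_le1.
have aMH := acceptance_MH _ _ _ s y _ _ _ mTheta mpi mh pi_gt0 h_gt0.
have aN := acceptance_noisy _ _ _ s y _ _ _ mTheta mpi mh pi_gt0 h_gt0 N.
(* The product of the lower bounds [c_h^-1] for the proposal density and [Dc^-1] for the acceptance
   probability. *)
pose kappa := (c_h * Dc)^-1.
have kappa0 : 0 < kappa by rewrite invr_gt0 mulr_gt0.
have minor t t' : Theta t -> Theta t' -> kappa <= h t t' * MH_acceptance _ _ _ s y pi h t t'.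
  move=> Tt Tt'; rewrite /kappa invfM; have /andP[hl _] := h_bnd _ _ Tt Tt'.
  apply: ler_pM => //; rewrite ?(ltW ci0) ?invr_ge0 ?(ltW Dc0)//.
  rewrite le_min invf_le1// Dc1 /=.
  exact: (alpha_ge _ _ _ s _ Theta_bnd y _ _ _ _ c_pi0 c_h0 pi_bnd h_bnd _ _ Tt Tt').
have ab t t' : Theta t -> Theta t' ->
    `|MH_acceptance _ _ _ s y pi h t t' - noisy_acceptance _ _ _ s y pi h N t t'|
      <= Dc / Num.sqrt N%:R.
  by move=> Tt Tt'; apply: le_trans (dist _ _ Tt Tt'); exact: acceptance_dist.
rewrite /law_after (iter_MH_opE _ _ _ _ _ _ _ _ mTheta mpi mh pi_gt0 h_gt0 h_int c_h)//.
rewrite iter_noisy_opE//.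
apply: le_trans (iter_accept_op_diff _ _ _ _ _ mTheta Theta_fin c_h0 mh h_le h_int
  _ _ _ _ aMH aN kappa0 minor ab n _ _ u1A Tth0) _.
have V1 := inv_le_volume _ _ _ _ _ mTheta Theta_fin c_h0 mh h_le h_int _ Tth0.
set V := LInt Theta (fun=> 1) in V1 *.
have V0 : 0 < V := lt_le_trans ci0 V1.
have -> : c_h ^+ 2 * Dc ^+ 2 / Num.sqrt N%:R = Dc / Num.sqrt N%:R / (kappa * c_h^-1).
  rewrite /kappa; field; rewrite !gt_eqF// sqrtr_gt0 ltr0n//.
rewrite ler_wpM2l ?divr_ge0 ?sqrtr_ge0 ?(ltW Dc0)//.
by rewrite lef_pV2 ?posrE ?mulr_gt0// ler_wpM2l// ltW.
Qed.
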